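(* Over all unweighted directed graphs $G$ of order $n$ with finite $\operatorname{ept}_{\mathrm{rzf}}(G)$, the maximum possible value of $\operatorname{ept}_{\mathrm{rzf}}(G)$ is $\Theta(n^2)$ (as $n\to\infty$).
   Context: Directed graphs are finite, without loops or multiple edges (edges in both directions between two vertices are allowed). The order is the number of vertices. Randomized zero forcing (RZF) on an unweighted directed graph $G$: start with blue set $B_0$. Given the blue set $B_t$, each white vertex $w\notin B_t$ independently becomes blue at round $t+1$ with probability equal to (number of in-neighbors of $w$ in $B_t$)/(indegree of $w$), and with probability $0$ if $w$ has indegree $0$; blue vertices stay blue forever. $\operatorname{ept}_{\mathrm{rzf}}(G,v)$ is the expected value of $\tau=\min\{t: B_t=V(G)\}$ started from $B_0=\{v\}$ if it is possible to color all of $G$ blue from $\{v\}$, and $\infty$ otherwise. $\operatorname{ept}_{\mathrm{rzf}}(G)=\min_{v\in V(G)}\operatorname{ept}_{\mathrm{rzf}}(G,v)$. *)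

(* Defs.v *)
From HB Require Import structures.
From mathcomp Require Export all_boot all_order all_algebra.
From mathcomp Require Export all_classical all_reals all_analysis.

Export Order.TTheory GRing.Theory Num.Theory.
Export numFieldNormedType.Exports.

Set Implicit Arguments.
Unset Strict Implicit.
Unset Printing Implicit Defensive.

Local Open Scope ring_scope.
Local Open Scope ereal_scope.

(* Digraphs are given by an arc relation: [E u w] is the arc from u to w. *)
Section RandomizedZeroForcing.
Variables (R : realType) (V : finType) (E : rel V).

Definition in_nbrs (w : V) : {set V} := [set u | E u w].

Definition force_prob (B : {set V}) (w : V) : R :=
  (if #|in_nbrs w| == 0%N then 0
   else #|in_nbrs w :&: B|%:R / #|in_nbrs w|%:R)%R.

(* P(B_{t+1} = B' | B_t = B): blue vertices stay blue, and the white vertices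
   change colour independently of each other. *)
Definition rzf_trans (B B' : {set V}) : R :=
  (if B \subset B' then
     \prod_(w | w \notin B)
       (if w \in B' then force_prob B w else 1 - force_prob B w)
   else 0)%R.

(* P(B_0 = S 0, ..., B_t = S t) for the chain started from the blue set {v}. *)
Definition rzf_path_prob (v : V) (t : nat) (S : {ffun 'I_t.+1 -> {set V}}) : R :=
  ((S ord0 == [set v])%:R *
   \prod_(i < t) rzf_trans (S (widen_ord (leqnSn t) i)) (S (lift ord0 i)))%R.

(* P(tau = t), summing over the trajectories that are all blue at time t and
   at no earlier time. *)
Definition rzf_time_prob (v : V) (t : nat) : R :=
  (\sum_(S : {ffun 'I_t.+1 -> {set V}} |
         [forall i, (S i == [set: V]) == (i == ord_max)])
     rzf_path_prob v S)%R.

Definition can_color_all (v : V) : Prop := exists t, (0 < rzf_time_prob v t)%R.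

(* When V can be coloured from {v}, tau is almost surely finite, so that its
   expectation is the sum of the series below. *)
Definition ept_rzf_from (v : V) : \bar R :=
  if `[< can_color_all v >]
  then \sum_(0 <= t <oo) (t%:R * rzf_time_prob v t)%:E
  else +oo.

Definition ept_rzf : \bar R := \big[mine/+oo]_(v : V) ept_rzf_from v.

End RandomizedZeroForcing.

(* [A] is the set of arcs (u, w) of a loopless digraph on n vertices. *)
Definition loopless (n : nat) (A : {set 'I_n * 'I_n}) : bool :=
  [forall u, (u, u) \notin A].

Definition arc (n : nat) (A : {set 'I_n * 'I_n}) : rel 'I_n :=
  fun u w => (u, w) \in A.

(* The default value 0 is harmless: the values of ept are nonnegative, and for
   every n > 0 some digraph of order n has a finite ept. *)
Definition max_ept_rzf (R : realType) (n : nat) : R :=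
  (\big[Num.max/0]_(A : {set 'I_n * 'I_n} |
       loopless A && (ept_rzf R (arc A) < +oo)%E)
     fine (ept_rzf R (arc A)))%R.

(* Main.v *)
Require Import Defs.
From mathcomp Require Import zify ring lra.

(* Upper bound: unless the whole digraph is blue, some white vertex has a blue
   in-neighbour, so that the number of blue vertices increases with probability
   at least 1/n in each round; hence the expected time is at most n^2.

   Lower bound: take the path 0 -> 1 -> ... -> n-1 together with all backward
   arcs that do not enter 0. As 0 has no in-neighbour, only {0} can colour the
   digraph; from there the blue set is always an initial segment, and it grows
   from k to k + 1 vertices with probability 1/(n - k), because vertex k has
   n - k in-neighbours and only one of them is blue. The expected time is
   therefore at least the sum of the n - k for 0 < k < n, i.e. n(n - 1)/2. *)

Set Implicit Arguments.
Unset Strict Implicit.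
Unset Printing Implicit Defensive.

Local Open Scope ring_scope.

(** * One-step analysis of the time to all blue, up to a finite horizon *)

Section HittingTime.
Variables (R : realType) (V : finType) (E : rel V).
Implicit Types (B : {set V}) (v w : V) (t T : nat).
Local Notation fprob := (force_prob R E).
Local Notation trans := (rzf_trans R E).

Lemma force_prob_ge0 B w : 0 <= fprob B w.
Proof. by rewrite /force_prob; case: ifP => // _; rewrite divr_ge0. Qed.

Lemma force_prob_le1 B w : fprob B w <= 1.
Proof.
rewrite /force_prob; case: ifP => [//|/negbT]; rewrite -lt0n => n0.
by rewrite ler_pdivrMr ?ltr0n// mul1r ler_nat subset_leq_card// subsetIl.
Qed.

Lemma trans_ge0 B B' : 0 <= trans B B'.
Proof.
rewrite /rzf_trans; case: ifP => // _; apply: prodr_ge0 => w _.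
by case: ifP; rewrite ?force_prob_ge0// subr_ge0 force_prob_le1.
Qed.

Lemma trans_nsub B B' : ~~ (B \subset B') -> trans B B' = 0.
Proof. by rewrite /rzf_trans => /negbTE ->. Qed.

Lemma sum_trans B : \sum_(B' : {set V}) trans B B' = 1.
Proof.
(* [F w] and [G w] are the chances that [w] is blue, resp. white, next round. Expanding the product
   of [F w + G w] gives one term per set [B'], and the term vanishes when [B'] loses a blue
   vertex. *)
pose F w := if w \in B then 1 else fprob B w.
pose G w := if w \in B then 0 else 1 - fprob B w.
transitivity (\prod_w (F w + G w)).
  rewrite bigA_distr; apply: eq_bigr => B' _.
  rewrite /rzf_trans [RHS](bigID (mem B))/=; case: ifPn => [BB'|].
    rewrite [X in _ = X * _]big1 ?mul1r; last by move=> w wB; rewrite /F wB (fintype.subsetP BB').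
    by apply: eq_bigr => w /negbTE wB; rewrite /F /G wB.
  by case/fintype.subsetPn => w wB wB'; rewrite (bigD1 w wB)/= (negbTE wB') /G wB !mul0r.
by rewrite big1// => w _; rewrite /F /G; case: ifP => _; rewrite ?addr0 ?subrKC.
Qed.

(** First-step recursion for P(tau = t) from the blue set [B]. The value 0 at the full set for
    positive times makes this a first hitting time. *)
Fixpoint hit_prob t B : R :=
  if t is t'.+1 then
    if B == [set: V] then 0 else \sum_(B' : {set V}) trans B B' * hit_prob t' B'
  else (B == [set: V])%:R.

Definition ffun_cons (T : Type) t (p : T * {ffun 'I_t -> T}) : {ffun 'I_t.+1 -> T} :=
  [ffun i => if unlift ord0 i is Some j then p.2 j else p.1].

Lemma ffun_cons0 (T : Type) t (p : T * {ffun 'I_t -> T}) : ffun_cons p ord0 = p.1.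
Proof. by rewrite ffunE unlift_none. Qed.

Lemma ffun_consS (T : Type) t (p : T * {ffun 'I_t -> T}) i :
  ffun_cons p (lift ord0 i) = p.2 i.
Proof. by rewrite ffunE liftK. Qed.

Lemma ffun_cons_bij (T : Type) t : bijective (@ffun_cons T t).
Proof.
exists (fun f : {ffun 'I_t.+1 -> T} => (f ord0, [ffun i : 'I_t => f (lift ord0 i)])) => [[x f]|f].
  by rewrite ffun_cons0/=; congr pair; apply/ffunP => i; rewrite ffunE ffun_consS.
apply/ffunP => i; case: (unliftP ord0 i) => [j ->|->].
  by rewrite ffun_consS ffunE.
by rewrite ffun_cons0.
Qed.

Lemma lift0_eq_max n (i : 'I_n.+1) : (lift ord0 i == ord_max) = (i == ord_max).
Proof. by rewrite -!val_eqE. Qed.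

(** Induction on [t], cutting off the first state of a trajectory: the chain started afresh from the
    second state has to hit the full set one round sooner. *)
Lemma sum_path_prob t B :
  \sum_(S : {ffun 'I_t.+1 -> {set V}} |
         [forall i, (S i == [set: V]) == (i == ord_max)])
     ((S ord0 == B)%:R *
      \prod_(i < t) trans (S (widen_ord (leqnSn t) i)) (S (lift ord0 i)))
  = hit_prob t B.
Proof.
elim: t B => [|t IH] B /=.
  rewrite (big_pred1 [ffun=> [set: V]]) ?big_ord0 ?ffunE ?mulr1 1?eq_sym//.
  move=> S; apply/forallP/eqP => [H|-> i]; last by rewrite ffunE !ord1 !eqxx.
  apply/ffunP => i; rewrite ffunE !ord1.
  by have /eqP := H ord0; rewrite [X in _ = X]eqxx => /eqP.
rewrite (reindex (@ffun_cons _ t.+1)); last exact/onW_bij/ffun_cons_bij.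
pose ends_at_max (S : {ffun 'I_t.+1 -> {set V}}) :=
  [forall i, (S i == [set: V]) == (i == ord_max)].
pose weight (S : {ffun 'I_t.+1 -> {set V}}) :=
  \prod_(i < t) trans (S (widen_ord (leqnSn t) i)) (S (lift ord0 i)).
(* [p.1] is the state at time 0, hence not full, and [p.2] is the remaining trajectory. *)
transitivity (\sum_(p : {set V} * {ffun 'I_t.+1 -> {set V}} |
    (p.1 != [set: V]) && ends_at_max p.2)
    ((p.1 == B)%:R * (trans p.1 (p.2 ord0) * weight p.2))).
  apply: eq_big => [[A S]|[A S] _] /=.
    apply/forallP/andP => [H|[/negbTE AT /forallP H] i].
      split; first by have := H ord0; rewrite ffun_cons0/= => /eqP ->.
      apply/forallP => i; have := H (lift ord0 i); rewrite ffun_consS/=.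
      by rewrite lift0_eq_max.
    case: (unliftP ord0 i) => [j ->|->]; last by rewrite ffun_cons0/= AT.
    by rewrite ffun_consS/= (eqP (H j)) lift0_eq_max.
  rewrite ffun_cons0/=; congr (_ * _).
  rewrite big_ord_recl ffun_consS/=; congr (_ * _).
    by rewrite (_ : widen_ord _ ord0 = ord0) ?ffun_cons0//; apply: val_inj.
  apply: eq_bigr => i _; rewrite ffun_consS/=.
  rewrite (_ : widen_ord _ (lift ord0 i) = lift ord0 (widen_ord (leqnSn t) i)).
    by rewrite ffun_consS.
  exact: val_inj.
rewrite -(pair_big (fun A => A != [set: V]) ends_at_max
  (fun A S => (A == B)%:R * (trans A (S ord0) * weight S)))/=.
case: ifPn => [/eqP ->|BT].
  by rewrite big1// => A AT; rewrite big1// => S _; rewrite (negbTE AT) mul0r.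
rewrite (bigD1 B)//= [X in _ + X]big1 ?addr0; last first.
  by move=> A /andP[_ /negbTE ->]; rewrite big1// => S _; rewrite mul0r.
(* The induction hypothesis brings in the indicator of [S ord0 == B'], which collapses the sum over
   [B']. *)
under [RHS]eq_bigr do rewrite -IH big_distrr/=.
rewrite exchange_big/=; apply: eq_bigr => S _.
rewrite eqxx mul1r (bigD1 (S ord0))//= eqxx mul1r [X in _ + X]big1 ?addr0//.
by move=> A; rewrite eq_sym => /negbTE ->; rewrite mul0r mulr0.
Qed.

Lemma rzf_time_probE v t : rzf_time_prob R E v t = hit_prob t [set v].
Proof. exact: sum_path_prob. Qed.

Lemma hit_prob_ge0 t B : 0 <= hit_prob t B.
Proof.
elim: t B => [|t IH] B //=; case: ifP => // _.
by apply: sumr_ge0 => B' _; rewrite mulr_ge0 ?trans_ge0.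
Qed.

(** A vertex outside [C] has all its in-neighbours outside [C], so its forcing probability is 0 and
    the blue set never leaves [C]. *)
Lemma hit_prob_closed (C : {set V}) t B : C != [set: V] ->
    (forall u w, u \in C -> E u w -> w \in C) ->
  B \subset C -> hit_prob t B = 0.
Proof.
move=> CT closedC; elim: t B => [|t IH] B BC /=.
  by case: eqP => // BT; rewrite -finset.subTset -BT BC in CT.
case: ifP => // _; apply: big1 => B' _.
have [B'C|/fintype.subsetPn[w wB' wC]] := boolP (B' \subset C); first by rewrite IH// mulr0.
rewrite /rzf_trans; case: ifP => _; last by rewrite mul0r.
have wB : w \notin B by apply: contra wC; apply: (fintype.subsetP BC).
suff fB0 : fprob B w = 0 by rewrite (bigD1 w)//= wB' fB0 !mul0r.
rewrite /force_prob; case: ifP => // _.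
suff -> : in_nbrs E w :&: B = finset.set0 by rewrite cards0 mul0r.
apply/finset.setP => u; rewrite !inE; apply/negP => /andP[Euw uB].
by case/negP: wC; apply: (closedC u) => //; apply: (fintype.subsetP BC).
Qed.

(** This is P(tau < T), with strict inequality; [hit_mean] is the expectation of tau restricted to
    the event tau < T. *)
Definition hit_cdf T B : R := \sum_(t < T) hit_prob t B.
Definition hit_mean T B : R := \sum_(t < T) t%:R * hit_prob t B.

Lemma hit_cdfT T : hit_cdf T.+1 [set: V] = 1.
Proof. by rewrite /hit_cdf big_ord_recl/= eqxx big1 ?addr0. Qed.

Lemma hit_meanT T : hit_mean T [set: V] = 0.
Proof.
rewrite /hit_mean big1// => -[[|t] ? _] /=; first by rewrite mul0r.
by rewrite eqxx mulr0.
Qed.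

Lemma hit_cdfS T B : B != [set: V] ->
  hit_cdf T.+1 B = \sum_(B' : {set V}) trans B B' * hit_cdf T B'.
Proof.
move=> /negbTE BT; rewrite /hit_cdf big_ord_recl/= BT add0r.
under [RHS]eq_bigr do rewrite big_distrr/=.
by rewrite exchange_big.
Qed.

(** After one round the weight [t.+1] splits into [t], giving [hit_mean], and 1, giving
    [hit_cdf]. *)
Lemma hit_meanS T B : B != [set: V] ->
  hit_mean T.+1 B
  = \sum_(B' : {set V}) trans B B' * (hit_mean T B' + hit_cdf T B').
Proof.
move=> /negbTE BT; rewrite /hit_mean /hit_cdf big_ord_recl/= BT mulr0 add0r.
under [RHS]eq_bigr do rewrite -big_split/= big_distrr/=.
rewrite exchange_big/=; apply: eq_bigr => t _.
rewrite big_distrr/=; apply: eq_bigr => B' _.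
by rewrite -natr1 mulrDl mul1r mulrDr; congr (_ + _); rewrite mulrCA.
Qed.

Lemma hit_cdf_le1 T B : hit_cdf T B <= 1.
Proof.
elim: T B => [|T IH] B; first by rewrite /hit_cdf big_ord0.
have [->|BT] := eqVneq B [set: V]; first by rewrite hit_cdfT.
rewrite hit_cdfS// -[leRHS](sum_trans B); apply: ler_sum => B' _.
by rewrite -[leRHS]mulr1 ler_wpM2l ?trans_ge0.
Qed.

Lemma hit_mean_ge0 T B : 0 <= hit_mean T B.
Proof. by apply: sumr_ge0 => t _; rewrite mulr_ge0 ?hit_prob_ge0. Qed.

(** Cut form of the condition that every vertex is reachable from [v]; [never_stuckP] identifies it
    with [can_color_all]. *)
Definition never_stuck v := forall B, v \in B -> B != [set: V] ->
  exists u w, [/\ u \in B, w \notin B & E u w].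

Lemma can_color_all_never_stuck v : can_color_all R E v -> never_stuck v.
Proof.
move=> [t]; rewrite rzf_time_probE => ht B vB BT.
apply: contrapT => stuck; move: ht.
rewrite (hit_prob_closed (C := B)) ?ltxx ?finset.sub1set// => u w uB Euw.
apply: contrapT => /negP wB; by apply: stuck; exists u, w.
Qed.

Lemma force_prob_lb B u w : u \in B -> E u w -> #|V|%:R^-1 <= fprob B w.
Proof.
move=> uB Euw; rewrite /force_prob.
have n0 : (0 < #|in_nbrs E w|)%N by apply/card_gt0P; exists u; rewrite inE.
have i0 : (0 < #|in_nbrs E w :&: B|)%N by apply/card_gt0P; exists u; rewrite !inE Euw.
have V0 : (0 < #|V|)%N := leq_trans n0 (max_card _).
rewrite gtn_eqF// -[leLHS]mul1r ler_pM ?invr_ge0 ?ler1n// lef_pV2 ?posrE ?ltr0n//.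
by rewrite ler_nat max_card.
Qed.

Lemma trans_stay B u w : u \in B -> w \notin B -> E u w ->
  trans B B <= 1 - #|V|%:R^-1.
Proof.
move=> uB wB Euw; rewrite /rzf_trans subxx (bigD1 w)//= (negbTE wB).
apply: (@le_trans _ _ (1 - fprob B w)); last by rewrite lerB// (force_prob_lb uB).
rewrite -[leRHS]mulr1 ler_wpM2l ?subr_ge0 ?force_prob_le1//.
apply: prodr_ile1 => x /andP[/negbTE -> _].
by rewrite subr_ge0 force_prob_le1 gerBl force_prob_ge0.
Qed.

(* The left-hand side is the expectation of [min(tau, T)]. *)
Lemma truncated_mean_le v T B : never_stuck v -> v \in B ->
  hit_mean T B + T%:R * (1 - hit_cdf T B) <= #|V|%:R * (#|V|%:R - #|B|%:R).
Proof.
move=> nsv; elim: T B => [|T IH] B vB.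
  rewrite /hit_mean big_ord0 mul0r addr0 mulr_ge0// subr_ge0 ler_nat.
  exact: max_card.
have [->|BT] := eqVneq B [set: V].
  by rewrite hit_meanT hit_cdfT cardsT !subrr !mulr0 addr0.
have [u [w [uB wB Euw]]] := nsv B vB BT.
have V0 : (0 < #|V|%:R :> R) by rewrite ltr0n; apply/card_gt0P; exists v.
(* One round passes, and then the minimum of the remaining time and [T] is left to wait. *)
have -> : hit_mean T.+1 B + T.+1%:R * (1 - hit_cdf T.+1 B) =
    1 + \sum_(B' : {set V}) trans B B' * (hit_mean T B' + T%:R * (1 - hit_cdf T B')).
  rewrite -[X in T.+1%:R * (X - _)](sum_trans B) -[X in _ = X + _](sum_trans B).
  rewrite hit_meanS// hit_cdfS// -sumrB big_distrr/= -!big_split/=.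
  by apply: eq_bigr => B' _; rewrite -natr1; ring.
(* A strict superset of [B] has at least one more vertex, which lowers the bound by [#|V|]; only
   staying at [B] forfeits this gain. As staying has probability at most [1 - #|V|%:R^-1], the
   average gain is at least 1 and pays for the round. *)
apply: (@le_trans _ _ (1 + (\sum_(B' : {set V}) trans B B' *
    (#|V|%:R * (#|V|%:R - #|B|%:R - 1)) + trans B B * #|V|%:R))).
  rewrite lerD2l (bigD1 B)//= [in leRHS](bigD1 B)//= addrAC -mulrDr lerD//.
    rewrite ler_wpM2l ?trans_ge0// (le_trans (IH _ vB))//; lra.
  apply: ler_sum => B' B'B.
  have [BB'|/trans_nsub ->] := boolP (B \subset B'); last by rewrite !mul0r.
  rewrite ler_wpM2l ?trans_ge0// (le_trans (IH _ (fintype.subsetP BB' _ vB)))//.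
  rewrite ler_pM2l// -addrA -opprD lerB// natr1 ler_nat proper_card//.
  by rewrite finset.properEneq eq_sym B'B.
rewrite -big_distrl/= sum_trans mul1r.
have := trans_stay uB wB Euw; rewrite -(ler_pM2r V0) mulrBl mul1r mulVf ?gt_eqF//.
lra.
Qed.

End HittingTime.

(** * Passage to the limit: the expected time as a real number *)

Section ExpectedHittingTime.
Variables (R : realType) (V : finType) (E : rel V).
Local Open Scope classical_set_scope.
Implicit Types (B : {set V}) (v w : V) (t T : nat).
Local Notation trans := (rzf_trans R E).
Local Notation cdf := (hit_cdf R E).
Local Notation mean := (hit_mean R E).

Lemma hit_mean_le v T B : never_stuck E v -> v \in B -> mean T B <= #|V|%:R ^+ 2.
Proof.
move=> nsv vB; apply: le_trans (le_trans (truncated_mean_le R T nsv vB) _).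
  by rewrite lerDl mulr_ge0// subr_ge0 hit_cdf_le1.
by rewrite expr2 ler_wpM2l// gerBl.
Qed.

Lemma nondecreasing_hit_mean B : nondecreasing_seq (mean ^~ B).
Proof.
apply/nondecreasing_seqP => T.
by rewrite /hit_mean big_ord_recr lerDl mulr_ge0 ?hit_prob_ge0.
Qed.

Lemma is_cvg_hit_mean v B : never_stuck E v -> v \in B -> cvgn (mean ^~ B).
Proof.
move=> nsv vB; apply: nondecreasing_is_cvgn (nondecreasing_hit_mean B) _.
by exists (#|V|%:R ^+ 2) => _ [T _ <-]; apply: hit_mean_le vB.
Qed.

(** Markov's inequality for the minimum of tau and [T.+1]. *)
Lemma hit_cdf_lb v T B : never_stuck E v -> v \in B ->
  1 - #|V|%:R ^+ 2 / T.+1%:R <= cdf T.+1 B.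
Proof.
move=> nsv vB; rewrite lerBlDr -lerBlDl ler_pdivlMr ?ltr0n// mulrC.
apply: le_trans (le_trans (truncated_mean_le R T.+1 nsv vB) _).
  by rewrite lerDr hit_mean_ge0.
by rewrite expr2 ler_wpM2l// gerBl.
Qed.

Lemma cvg_hit_cdf v B : never_stuck E v -> v \in B -> cdf T B @[T --> \oo] --> (1 : R).
Proof.
move=> nsv vB; rewrite -cvg_shiftS.
have lb_cvg : 1 - #|V|%:R ^+ 2 / T.+1%:R @[T --> \oo] --> (1 : R).
  rewrite -[X in _ --> X]subr0 -[X in _ --> _ - X](mulr0 (#|V|%:R ^+ 2)).
  by apply: cvgB; [exact: cvg_cst | apply: cvgMr; exact: cvg_harmonic].
apply: (squeeze_cvgr _ lb_cvg (cvg_cst _)); near=> T.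
by rewrite (hit_cdf_lb T nsv vB) hit_cdf_le1.
Unshelve. all: by end_near. Qed.

Lemma never_stuckP v : can_color_all R E v <-> never_stuck E v.
Proof.
split=> [|nsv]; first exact: can_color_all_never_stuck.
apply: contrapT => no_hit.
have hit0 t : hit_prob R E t [set v]%SET = 0.
  apply/eqP; rewrite eq_le hit_prob_ge0 andbT leNgt; apply/negP => ht.
  by apply: no_hit; exists t; rewrite rzf_time_probE.
(* If the full set were never hit, the truncated mean would equal the horizon, so a horizon beyond
   [#|V| ^ 2] contradicts the bound. *)
have := truncated_mean_le R (#|V| ^ 2).+1 nsv (finset.set11 v).
rewrite /hit_cdf /hit_mean !big1; try by move=> t _; rewrite hit0 ?mulr0.
rewrite subr0 mulr1 add0r cards1 leNgt => /negP; apply.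
rewrite -[((#|V| ^ 2).+1)%:R]natr1 natrX expr2 mulrBr mulr1.
by rewrite (@le_lt_trans _ _ (#|V|%:R * #|V|%:R))// ?gerBl// ltrDl.
Qed.

Definition mean_hit B : R := limn (mean ^~ B).

Lemma mean_hit_ge0 v B : never_stuck E v -> v \in B -> 0 <= mean_hit B.
Proof.
move=> nsv vB; apply: limr_ge; first exact: is_cvg_hit_mean vB.
by near=> T; exact: hit_mean_ge0.
Unshelve. all: by end_near. Qed.

Lemma mean_hit_le v B : never_stuck E v -> v \in B -> mean_hit B <= #|V|%:R ^+ 2.
Proof.
move=> nsv vB; apply: limr_le; first exact: is_cvg_hit_mean vB.
by near=> T; exact: hit_mean_le vB.
Unshelve. all: by end_near. Qed.

(** Limit of [hit_meanS]: the [hit_cdf] terms tend to 1, so their weighted sum tends to the total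
    transition probability 1. *)
Lemma mean_hit_step v B : never_stuck E v -> v \in B -> B != finset.setT ->
  mean_hit B = 1 + \sum_(B' : {set V}) trans B B' * mean_hit B'.
Proof.
move=> nsv vB BT.
rewrite -[X in X + _](sum_trans R E B) -big_split/=; apply: cvg_lim => //.
rewrite -cvg_shiftS; under eq_fun do rewrite hit_meanS//.
apply: cvg_big => [|B' _]; first exact: add_continuous.
(* Convergence is available only for sets containing [v]; the sets that do not contain [B] have
   weight 0. *)
have [BB'|/trans_nsub ->] := boolP (B \subset B'); last first.
  by rewrite mul0r addr0; under eq_fun do rewrite mul0r; exact: cvg_cst.
have vB' := fintype.subsetP BB' v vB.
rewrite -[X in X + _]mulr1 -mulrDr addrC; apply: cvgMr; apply: cvgD.
  exact: is_cvg_hit_mean vB'.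
exact: cvg_hit_cdf vB'.
Qed.

Lemma ept_rzf_fromE v : never_stuck E v ->
  ept_rzf_from R E v = (mean_hit [set v]%SET)%:E.
Proof.
move=> nsv; rewrite /ept_rzf_from asboolT; last exact/never_stuckP.
rewrite -EFin_lim; last exact: is_cvg_hit_mean nsv (finset.set11 v).
congr (limn _); apply/funext => T /=; rewrite sumEFin big_mkord; congr (_%:E).
by apply: eq_bigr => t _; rewrite rzf_time_probE.
Qed.

Lemma ept_rzf_le : (ept_rzf R E < +oo)%E -> (ept_rzf R E <= (#|V|%:R ^+ 2)%:E)%E.
Proof.
rewrite ltNge => /negP finite.
have [v nsv] : exists v, never_stuck E v.
  apply: contrapT => stuck; apply: finite; apply/bigmin_geP; split=> // v _.
  rewrite /ept_rzf_from asboolF// => /never_stuckP nsv.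
  by apply: stuck; exists v.
apply: (@bigmin_inf _ _ _ _ v) => //.
by rewrite ept_rzf_fromE// lee_fin; apply: mean_hit_le nsv (finset.set11 v).
Qed.

End ExpectedHittingTime.

(** * The digraph with quadratic expected time *)

Lemma card_ord_lt n k : (k <= n)%N -> #|[set i : 'I_n | (i < k)%N]%SET| = k.
Proof.
move=> kn; rewrite -sum1dep_card -(big_ord_widen n (fun=> 1%N) kn).
by rewrite sum1_card card_ord.
Qed.

Definition slow_digraph n : {set 'I_n * 'I_n} :=
  [set p : 'I_n * 'I_n | [&& (0 < p.2)%N, p.1 != p.2 & (p.2 <= p.1.+1)%N]]%SET.

Section SlowDigraph.
Variables (R : realType) (N : nat).
Local Notation n := N.+1.
Local Notation E := (arc (slow_digraph n)).
Local Notation trans := (rzf_trans R E).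
Implicit Types (k : nat) (u w : 'I_n).

Lemma arc_slow u w : E u w = [&& (0 < w)%N, u != w & (w <= u.+1)%N].
Proof. by rewrite /arc inE. Qed.

Lemma slow_loopless : loopless (slow_digraph n).
Proof. by apply/forallP => u; rewrite inE/= eqxx andbF. Qed.

Lemma slow_never_stuck v : never_stuck E v <-> v = ord0.
Proof.
split=> [nsv|-> B B0 BT].
  apply/eqP/negPn/negP => v0.
  (* No arc enters 0, so the set of all other vertices is stuck. *)
  have [||u [w [_]]] := nsv (~: [set ord0])%SET; first by rewrite !inE.
    by apply/eqP => /finset.setP/(_ ord0); rewrite !inE eqxx.
  by rewrite !inE negbK => /eqP ->; rewrite arc_slow.
have [w0 w0B] : exists w, w \notin B.
  by apply/existsP; rewrite -negb_forall; apply: contra BT => /forallP BT;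
     apply/eqP/finset.setP => w; rewrite inE BT.
(* The least white vertex [w] is positive and its predecessor on the path is blue. *)
case: (@arg_minnP _ w0 (fun w => w \notin B) (fun w => w : nat) w0B) => w wB wmin.
have w0' : (0 < w)%N.
  by rewrite lt0n; apply: contra wB => /eqP w0'; rewrite (_ : w = ord0)//; apply: val_inj.
have wn : (w.-1 < n)%N by rewrite (leq_ltn_trans (leq_pred _)).
exists (Ordinal wn), w; split => //.
  by apply/negPn/negP => /wmin/=; rewrite leqNgt prednK// leqnn.
rewrite arc_slow w0'/= prednK// leqnn andbT -val_eqE/= neq_ltn.
by rewrite prednK// leqnn.
Qed.

Definition init_seg k : {set 'I_n} := [set i : 'I_n | (i < k)%N]%SET.

(** The in-neighbours of [k] are the vertices from [k.-1] on, except [k] itself. *)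
Lemma card_in_nbrs_slow (k : 'I_n) : (0 < k)%N -> #|in_nbrs E k| = (n - k)%N.
Proof.
move=> k0.
have -> : in_nbrs E k = (~: init_seg k.-1 :\ k)%SET.
  apply/finset.setP => u; rewrite !inE arc_slow k0/= -leqNgt.
  by congr andb; move: k0; lia.
have := cardsD1 k (~: init_seg k.-1)%SET.
have -> : k \in (~: init_seg k.-1)%SET by rewrite !inE -leqNgt leq_pred.
have := cardsC (init_seg k.-1); rewrite card_ord_lt ?card_ord//; last first.
  by rewrite (leq_trans (leq_pred _))// ltnW.
move: k0 (ltn_ord k) #|(~: init_seg k.-1 :\ k)%SET| #|(~: init_seg k.-1)%SET| => ? ? a b.
lia.
Qed.

Lemma force_prob_slow (k : 'I_n) : (0 < k)%N ->
  force_prob R E (init_seg k) k = (n - k)%:R^-1.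
Proof.
move=> k0; rewrite /force_prob card_in_nbrs_slow// gtn_eqF ?subn_gt0//.
suff -> : #|in_nbrs E k :&: init_seg k|%SET = 1%N by rewrite mul1r.
have kn : (k.-1 < n)%N by rewrite (leq_ltn_trans (leq_pred _)).
apply/eqP/cards1P; exists (Ordinal kn); apply/finset.setP => u.
rewrite !inE arc_slow -!val_eqE/=.
move: k0; lia.
Qed.

(** The in-neighbours of [w] are at least [w.-1], hence at least [k], and so all white. *)
Lemma force_prob_slow0 (k w : 'I_n) : (k < w)%N -> force_prob R E (init_seg k) w = 0.
Proof.
move=> kw; rewrite /force_prob; case: ifP => // _.
suff -> : (in_nbrs E w :&: init_seg k)%SET = finset.set0 by rewrite cards0 mul0r.
apply/finset.setP => u; rewrite !inE arc_slow.
move: kw; lia.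
Qed.

Lemma trans_slow_stay (k : 'I_n) : (0 < k)%N ->
  trans (init_seg k) (init_seg k) = 1 - (n - k)%:R^-1.
Proof.
move=> k0; rewrite /rzf_trans subxx (bigD1 k) ?inE ?ltnn//= force_prob_slow//.
rewrite big1 ?mulr1// => w /andP[]; rewrite inE -leqNgt => kw wk.
by rewrite ltnNge kw/= force_prob_slow0 ?subr0// ltn_neqAle kw eq_sym wk.
Qed.

Lemma trans_slow_move (k : 'I_n) : (0 < k)%N ->
  trans (init_seg k) (init_seg k.+1) = (n - k)%:R^-1.
Proof.
move=> k0; rewrite /rzf_trans ifT; last first.
  by apply/fintype.subsetP => w; rewrite !inE => /ltnW.
rewrite (bigD1 k) ?inE ?ltnn//= ltnSn force_prob_slow//.
rewrite big1 ?mulr1// => w /andP[]; rewrite !inE -leqNgt => kw wk.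
have kw' : (k < w)%N by rewrite ltn_neqAle kw eq_sym wk.
by rewrite ltnNge kw'/= force_prob_slow0 ?subr0.
Qed.

(** In the first-step equation only the two transitions to [init_seg k] and [init_seg k.+1] are
    kept, the others being nonnegative; multiplying by [n - k] then isolates the waiting time. *)
Lemma mean_hit_slow_step (k : 'I_n) : (0 < k)%N ->
  (n - k)%:R + mean_hit R E (init_seg k.+1) <= mean_hit R E (init_seg k).
Proof.
move=> k0.
have ns0 : never_stuck E ord0 by apply/slow_never_stuck.
have k_seg : ord0 \in init_seg k by rewrite inE.
have c0 : (0 : R) < (n - k)%:R by rewrite ltr0n subn_gt0.
have : 1 + ((1 - (n - k)%:R^-1) * mean_hit R E (init_seg k) +
    (n - k)%:R^-1 * mean_hit R E (init_seg k.+1)) <= mean_hit R E (init_seg k).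
  rewrite [leRHS](mean_hit_step _ ns0 k_seg); last first.
    by apply/eqP => /finset.setP/(_ k); rewrite !inE ltnn.
  rewrite lerD2l (bigD1 (init_seg k))//= (bigD1 (init_seg k.+1))/=; last first.
    by apply/eqP => /finset.setP/(_ k); rewrite !inE ltnn ltnSn.
  rewrite trans_slow_stay// trans_slow_move// lerD2l lerDl sumr_ge0// => B _.
  have [segB|/trans_nsub ->] := boolP (init_seg k \subset B); last by rewrite mul0r.
  rewrite mulr_ge0 ?trans_ge0//.
  exact: mean_hit_ge0 ns0 (fintype.subsetP segB _ k_seg).
rewrite -(ler_pM2l c0) !mulrDr mulr1 !mulrA mulrBr mulr1 divff ?gt_eqF// mul1r mulrBl mul1r.
lra.
Qed.

(** Induction on the number [m] of white vertices: with [m.+1] of them the wait for the next vertex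
    is [m.+1], and these waits add up to a triangular number. *)
Lemma mean_hit_slow_ge m : (m < n)%N ->
  (m * m.+1)%:R / 2 <= mean_hit R E (init_seg (n - m)).
Proof.
elim: m => [_|m IH mn].
  rewrite mul0r; apply: (@mean_hit_ge0 _ _ _ ord0); first exact/slow_never_stuck.
  by rewrite inE.
have kn : (n - m.+1 < n)%N by rewrite subSS ltnS leq_subr.
have := @mean_hit_slow_step (Ordinal kn); rewrite /= subn_gt0 mn subKn ?(ltnW mn)//.
rewrite -subSn; last exact: ltnW.
rewrite subSS => /(_ isT); have := IH (ltnW mn).
by rewrite !natrM -[m.+2%:R]natr1 -[m.+1%:R]natr1; lra.
Qed.

Lemma init_seg1 : init_seg 1 = [set ord0]%SET.
Proof. by apply/finset.setP => i; rewrite !inE -val_eqE/= ltnS leqn0. Qed.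

Lemma ept_slow_lt_pinfty : (ept_rzf R E < +oo)%E.
Proof.
apply: (@le_lt_trans _ _ (ept_rzf_from R E ord0)); first exact: bigmin_le.
by rewrite ept_rzf_fromE ?ltry//; exact/slow_never_stuck.
Qed.

Lemma ept_slow_ge : (((N * n)%:R / 2)%:E <= ept_rzf R E)%E.
Proof.
apply/bigmin_geP; split=> [|v _]; first exact: leey.
have [->|v0] := eqVneq v ord0.
  rewrite ept_rzf_fromE; last exact/slow_never_stuck.
  by rewrite lee_fin; have := mean_hit_slow_ge (ltnSn N); rewrite subSnn init_seg1.
rewrite /ept_rzf_from asboolF ?leey// => /never_stuckP/slow_never_stuck.
exact/eqP.
Qed.

End SlowDigraph.

(** * Bounds on the maximum and its order of growth *)

Lemma max_ept_rzf_le (R : realType) n : max_ept_rzf R n <= n%:R ^+ 2.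
Proof.
apply: bigmax_le => [|A /andP[_ finA]]; first exact: exprn_ge0.
have := ept_rzf_le finA; rewrite card_ord.
by case: (ept_rzf R (arc A)) finA => [x|//|] //= _.
Qed.

Lemma max_ept_rzf_ge (R : realType) n :
  (n * n.-1)%:R / 2 <= max_ept_rzf R n.
Proof.
case: n => [|N]; first by rewrite mul0n mul0r bigmax_ge_id.
have finA := ept_slow_lt_pinfty R N.
apply: (@bigmax_sup _ _ _ _ (slow_digraph N.+1)); first by rewrite slow_loopless.
(* [fine] keeps the value since it is finite: [finA] excludes [+oo], and the lower bound excludes
   [-oo]. *)
rewrite mulnC -lee_fin fineK ?ept_slow_ge// fin_numE -ltey finA andbT.
by rewrite gt_eqF// (lt_le_trans _ (ept_slow_ge R N)) ?ltNyr.
Qed.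

Local Open Scope classical_set_scope.
Local Open Scope ring_scope.

Theorem corollary4p4 (R : realType) :
  max_ept_rzf R \is 'Theta_\oo (fun n : nat => n%:R ^+ 2 : R).
Proof.
(* For [n >= 2], [n * (n - 1) / 2] is at least [n ^ 2 / 4]. *)
apply/asboolP; exists (4^-1, 1) => /=; first by rewrite invr_gt0 ltr0n ltr01.
near=> n; have n2 : (2 <= n)%N by near: n; exact: nbhs_infty_ge.
have lb := max_ept_rzf_ge R n.
have norm_max : `|max_ept_rzf R n| = max_ept_rzf R n.
  by rewrite ger0_norm// (le_trans _ lb)// divr_ge0.
have norm_sq : `|n%:R ^+ 2 : R| = n%:R ^+ 2 by rewrite ger0_norm.
rewrite norm_max norm_sq mul1r; split; last exact: max_ept_rzf_le.
apply: le_trans lb; rewrite natrM -subn1 natrB ?(ltnW n2)//.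
have : (2 : R) <= n%:R by rewrite ler_nat.
nra.
Unshelve. all: by end_near. Qed.
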